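(* Let $V$ and $\widetilde V$ be finite-dimensional real inner product spaces, let $A\colon V\to V$ be symmetric positive semidefinite with $A\neq 0$, let $\Pi\colon\widetilde V\to V$ be a surjective linear operator, let $\widetilde B\colon\widetilde V\to\widetilde V$ be an SPD linear operator, and set $B=\Pi\widetilde B\Pi^t$. Then $$\lambda_{\min}(BA)=\left(\sup_{v\in\mathcal R(A),\ |v|_A=1}\ \inf_{\phi\in\mathcal N(A)}\ \inf_{\tilde v\in\widetilde V,\ \Pi\tilde v=v+\phi}(\widetilde B^{-1}\tilde v,\tilde v)\right)^{-1},$$ $$\lambda_{\max}(BA)=\left(\inf_{v\in\mathcal R(A),\ |v|_A=1}\ \inf_{\phi\in\mathcal N(A)}\ \inf_{\tilde v\in\widetilde V,\ \Pi\tilde v=v+\phi}(\widetilde B^{-1}\tilde v,\tilde v)\right)^{-1}.$$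
   Context: All inner products are denoted $(\cdot,\cdot)$; $T^t$ is the adjoint, $\mathcal N(T)$ the null space, $\mathcal R(T)$ the range of a linear operator $T$. A symmetric operator $T$ is SPD if $(Tv,v)>0$ for all $v\ne0$, and symmetric positive semidefinite if $(Tv,v)\ge 0$ for all $v$; then $|v|_T=(Tv,v)^{1/2}$. Here $\lambda_{\min}(BA)$ denotes the smallest nonzero eigenvalue of $BA$ and $\lambda_{\max}(BA)$ the largest eigenvalue of $BA$. *)

(* Defs.v *)
From HB Require Import structures.
From mathcomp Require Import all_boot all_order all_algebra.
From mathcomp Require Import all_classical all_reals.

Set Implicit Arguments.
Unset Strict Implicit.
Unset Printing Implicit Defensive.

Import Order.TTheory GRing.Theory Num.Theory.
Local Open Scope classical_set_scope.
Local Open Scope ring_scope.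

(* A finite-dimensional real inner product space is a vectType R equipped with
   a positive definite symmetric bilinear form, {dot V for idfun}. *)

Section InnerProduct.
Variables (R : realType) (U V : vectType R).
Variables (ipU : {dot U for idfun}) (ipV : {dot V for idfun}).

Definition is_adjoint (T : 'Hom(U, V)) (S : 'Hom(V, U)) : Prop :=
  forall u v, ipV (T u) v = ipU u (S v).

(* The default value 0 is never used: see adjointP. *)
Definition adjoint (T : 'Hom(U, V)) : 'Hom(V, U) := xget 0 (is_adjoint T).

Definition symmetric_op (T : 'End(V)) : Prop :=
  forall u v, ipV (T u) v = ipV u (T v).

Definition spd (T : 'End(V)) : Prop :=
  symmetric_op T /\ forall v, v != 0 -> 0 < ipV (T v) v.

Definition sym_pos_semidef (T : 'End(V)) : Prop :=
  symmetric_op T /\ forall v, 0 <= ipV (T v) v.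

Definition seminorm_of (T : 'End(V)) (v : V) : R := Num.sqrt (ipV (T v) v).

End InnerProduct.

Section AdjointTheory.
Variables (R : realType) (U V : vectType R).
Variables (ipU : {dot U for idfun}) (ipV : {dot V for idfun}).
Implicit Types (T : 'Hom(U, V)) (S : 'Hom(V, U)).

Lemma riesz (f : 'Hom(U, R^o)) : exists s, forall u, ipU u s = f u.
Proof.
have linl s : linear (fun u => ipU u s : R^o).
  by move=> a x y; rewrite linearPl.
pose dl s : {linear U -> R^o} :=
  HB.pack (fun u => ipU u s : R^o) (GRing.isLinear.Build _ _ _ _ _ (linl s)).
have dlE s u : linfun (dl s) u = ipU u s by rewrite lfunE.
have linr : linear (fun s => linfun (dl s)).
  by move=> a x y; apply/lfunP => u; rewrite add_lfunE scale_lfunE !dlE linearPr.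
pose d : {linear U -> 'Hom(U, R^o)} :=
  HB.pack (fun s => linfun (dl s)) (GRing.isLinear.Build _ _ _ _ _ linr).
have dE s u : linfun d s u = ipU u s by rewrite lfunE dlE.
have ker0 : lker (linfun d) == 0%VS.
  apply/lker0P => x y /lfunP/(_ (x - y)); rewrite !dE => /eqP.
  rewrite -subr_eq0 -linearBr => /eqP xy0; apply/eqP; rewrite -subr_eq0.
  apply/negPn/negP => /(@neq0_dnorm_gt0 _ _ _ ipU).
  by rewrite xy0 ltxx.
have full : limg (linfun d) = fullv.
  apply/eqP; rewrite eqEdim subvf /= limg_dim_eq ?(eqP ker0) ?capv0 //.
  by rewrite !dimvf /dim /= muln1.
have : f \in limg (linfun d) by rewrite full memvf.
by case/memv_imgP => s _ fE; exists s => u; rewrite fE dE.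
Qed.

Lemma adjointP T : is_adjoint ipU ipV T (adjoint ipU ipV T).
Proof.
rewrite /adjoint; case: xgetP => // no_adj; exfalso.
have linl w : linear (fun u => ipV (T u) w : R^o).
  by move=> a x y; rewrite linearP linearPl.
pose l w : {linear U -> R^o} :=
  HB.pack (fun u => ipV (T u) w : R^o) (GRing.isLinear.Build _ _ _ _ _ (linl w)).
have /choice[s sP] : forall w, exists s, forall u, ipU u s = ipV (T u) w.
  move=> w; have [s sP] := riesz (linfun (l w)).
  by exists s => u; rewrite sP lfunE.
have lins : linear s.
  move=> a x y; apply/eqP; rewrite -subr_eq0; apply/negPn/negP.
  move=> /(@neq0_dnorm_gt0 _ _ _ ipU); rewrite linearBr linearPr /= !sP linearPr.
  by rewrite subrr ltxx.
pose S : {linear V -> U} := HB.pack s (GRing.isLinear.Build _ _ _ _ _ lins).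
by apply: (no_adj (linfun S)) => u v; rewrite lfunE /= sP.
Qed.

Lemma adjoint_unique T S :
  is_adjoint ipU ipV T S -> S = adjoint ipU ipV T.
Proof.
move=> adjS; apply/lfunP => v; apply/eqP; rewrite -subr_eq0; apply/negPn/negP.
move=> /(@neq0_dnorm_gt0 _ _ _ ipU); rewrite linearBr /= -adjS -adjointP.
by rewrite subrr ltxx.
Qed.

End AdjointTheory.

Section Eigenvalues.
Variables (R : realType) (V : vectType R).
Implicit Types (T : 'End(V)) (l m : R).

(* Only real eigenvalues are considered; for T = BA, with B SPD and A symmetric
   positive semidefinite, all complex eigenvalues are real. *)
Definition is_lambda_min T l : Prop :=
  [/\ passmx.leigenvalue T l, l != 0 &
      forall m, passmx.leigenvalue T m -> m != 0 -> l <= m].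

Definition is_lambda_max T l : Prop :=
  passmx.leigenvalue T l /\ forall m, passmx.leigenvalue T m -> m <= l.

End Eigenvalues.

(* Main.v *)
(* Write [e x y = (B^-1 x, y)]. The infimum of [(Bt^-1 w, w)] over [Pi w = x]
   equals [e x x], and [BA] is [e]-symmetric with [e (BA x) x = (Ax, x)].
   A symmetric operator [S] has an eigenvector for [mu = sup e (S x) x / e x x]
   on any invariant subspace: otherwise [T = mu - S] would be invertible there,
   and testing its positivity at [N x - T^-1 x] for large [N] would bound the
   Rayleigh quotient away from [mu].  Applied to [BA] on the whole space this
   gives the largest eigenvalue; applied to [- BA] on the range of [BA], the
   [e]-orthogonal complement of the kernel of [A], it gives the smallest
   nonzero one.  *)
From HB Require Import structures.
Require Import Defs.
From mathcomp Require Import all_boot all_order all_algebra.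
From mathcomp Require Import all_classical all_reals ereal.
From mathcomp Require Import ring lra.

Import Order.TTheory GRing.Theory Num.Theory.
Local Open Scope classical_set_scope.
Local Open Scope ring_scope.

Set Implicit Arguments.
Unset Strict Implicit.
Unset Printing Implicit Defensive.

(** * Real inner products and symmetric operators *)

Section Dot.
Variables (R : realType) (V : vectType R) (d : {dot V for idfun}).
Implicit Types (x y : V) (S : 'End(V)) (U : {vspace V}).

Lemma dotC x y : d x y = d y x.
Proof. by rewrite hermC expr0 mul1r. Qed.

Lemma dotDl x y z : d (x + y) z = d x z + d y z.
Proof. exact: linearDl. Qed.

Lemma dotNl x z : d (- x) z = - d x z.
Proof. exact: linearNl. Qed.

Lemma dotZl a x z : d (a *: x) z = a * d x z.
Proof. exact: linearZl_LR. Qed.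

Lemma dotDr x y z : d z (x + y) = d z x + d z y.
Proof. exact: linearDr. Qed.

Lemma dotNr x z : d z (- x) = - d z x.
Proof. exact: linearNr. Qed.

Lemma dotZr a x z : d z (a *: x) = a * d z x.
Proof. exact: linearZr_LR. Qed.

Definition dotE := (dotDl, dotNl, dotZl, dotDr, dotNr, dotZr).

Lemma dot_eq0 x : (d x x == 0) = (x == 0).
Proof.
apply/eqP/eqP => [xx0|->]; last by rewrite linear0l.
apply/eqP/negPn/negP => /(@neq0_dnorm_gt0 _ _ _ d).
by rewrite xx0 ltxx.
Qed.

Lemma dot_ge0 x : 0 <= d x x.
Proof.
by have [->|/(@neq0_dnorm_gt0 _ _ _ d)/ltW//] := eqVneq x 0; rewrite linear0l.
Qed.

Lemma dot_inj x y : (forall z, d x z = d y z) -> x = y.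
Proof.
by move=> xy; apply/eqP; rewrite -subr_eq0 -dot_eq0 !dotDl !dotNl xy subrr.
Qed.

Lemma dot_cauchy_schwarz x y : d x y ^+ 2 <= d x x * d y y.
Proof.
have [->|/(@neq0_dnorm_gt0 _ _ _ d) y0] := eqVneq y 0.
  by rewrite !linear0r expr0n mulr0.
(* This vector is [d y y] times the component of [x] orthogonal to [y], which avoids a division. *)
have := dot_ge0 (d y y *: x - d x y *: y).
rewrite !dotE (dotC y x) -subr_ge0.
set e := (X in 0 <= X -> _).
have -> : e = d y y * (d x x * d y y - d x y ^+ 2) by rewrite /e; ring.
by rewrite pmulr_rge0.
Qed.

(* Riesz representation makes the coordinates of [x] bounded with respect to [d]. *)
Lemma rayleigh_bounded S : exists2 M, 0 < M & forall x, d (S x) x <= M * d x x.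
Proof.
pose e := vbasis (@fullv _ V).
have /choice[s sP] : forall i : 'I_(\dim (@fullv _ V)),
    exists s, forall x, d x s = coord e i x.
  move=> i; have [s sP] := riesz d (linfun (coord e i : V -> R^o)).
  by exists s => x; rewrite sP lfunE.
pose K i := d (s i) (s i) + d (S e`_i) (S e`_i).
have K0 i : 0 <= K i by rewrite addr_ge0 ?dot_ge0.
exists (1 + \sum_i K i) => [|x].
  by rewrite ltr_wpDr // sumr_ge0.
rewrite [in d (S x)](coord_vbasis (memvf x)) linear_sum linear_sumlz /= mulrDl mul1r.
rewrite -[leLHS]add0r lerD ?dot_ge0 // mulr_suml; apply: ler_sum => i _.
rewrite linearZ /= dotZl -sP /K.
(* The product of the two inner products is at most half the sum of their squares; Cauchy-Schwarz
   bounds each square by a multiple of [d x x]. *)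
have := dot_cauchy_schwarz x (s i); have := dot_cauchy_schwarz x (S e`_i).
rewrite (dotC x (S _)).
have := sqr_ge0 (d x (s i) - d (S e`_i) x).
have := dot_ge0 x; have := dot_ge0 (s i); have := dot_ge0 (S e`_i).
nra.
Qed.

Lemma sym_max_eigenvector S U : symmetric_op d S -> U != 0%VS ->
    (forall x, x \in U -> S x \in U) ->
  exists mu, (exists x, [/\ x \in U, x != 0 & S x = mu *: x]) /\
    forall x, x \in U -> d (S x) x <= mu * d x x.
Proof.
move=> symS U0 SU.
pose E := [set d (S x) x / d x x | x in [set x | x \in U /\ x != 0]].
have [M _ SM] := rayleigh_bounded S.
have E_ub : has_ubound E.
  exists M => _ [x [_ x0] <-].
  by rewrite ler_pdivrMr ?SM // neq0_dnorm_gt0.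
have E0 : E !=set0.
  exists (d (S (vpick U)) (vpick U) / d (vpick U) (vpick U)).
  by exists (vpick U) => //; split; rewrite ?memv_pick ?vpick0.
pose mu := sup E.
have rayleigh x : x \in U -> d (S x) x <= mu * d x x.
  move=> xU; have [->|x0] := eqVneq x 0; first by rewrite !linear0r mulr0.
  rewrite -ler_pdivrMr ?neq0_dnorm_gt0 //; apply: ub_le_sup => //.
  by exists x.
exists mu; split=> //; apply: contrapT => no_eig.
pose T : 'End(V) := mu *: \1%VF - S.
have TE x : T x = mu *: x - S x.
  by rewrite add_lfunE scale_lfunE id_lfunE opp_lfunE.
have kerT : (U :&: lker T = 0)%VS.
  apply/eqP; rewrite -subv0; apply/subvP => x.
  rewrite memv_cap memv_ker memv0 TE subr_eq0 => /andP[xU /eqP Sx].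
  by apply/negPn/negP => x0; apply: no_eig; exists x.
have TU : (T @: U)%VS = U.
  apply/eqP; rewrite eqEdim limg_dim_eq // leqnn andbT.
  apply/subvP => _ /memv_imgP[x xU ->].
  by rewrite TE rpredB ?rpredZ ?SU.
pose Tp : 'End(V) := (T \o projv U)%VF.
pose Z : 'End(V) := (projv U \o Tp^-1)%VF.
have ZU x : Z x \in U by rewrite comp_lfunE memv_proj.
have TZ x : x \in U -> T (Z x) = x.
  move=> xU; rewrite comp_lfunE -[T _]comp_lfunE limg_lfunVK //.
  by rewrite limg_comp limg_proj TU.
have [N N0 ZN] := rayleigh_bounded Z.
have gap x : x \in U -> d (S x) x <= (mu - N^-1) * d x x.
  move=> xU.
  (* Since [T (Z x) = x], this reads [N^2 d (T x) x - 2 N d x x + d (Z x) x >= 0], and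
     [d (Z x) x <= N d x x] absorbs half of the middle term. *)
  have := rayleigh _ (memvB (memvZ N xU) (ZU x)).
  rewrite -subr_ge0 -dotZl -dotNl -dotDl -TE.
  have -> : T (N *: x - Z x) = N *: T x - x by rewrite linearB linearZ /= TZ.
  rewrite !dotE.
  have -> : d (T x) (Z x) = d x x.
    by transitivity (d x (T (Z x))); [rewrite !TE !dotE symS|rewrite TZ].
  have := ZN x; rewrite (dotC (Z x)) TE !dotE => xZ pos.
  have : N * (d x x) <= N * (N * (mu * d x x - d (S x) x)).
    rewrite -subr_ge0.
    apply: le_trans pos _; lra.
  rewrite ler_pM2l // -ler_pdivrMl //; lra.
have : mu <= mu - N^-1.
  apply: ge_sup => // _ [x [xU x0] <-].
  by rewrite ler_pdivrMr ?neq0_dnorm_gt0 ?gap.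
by rewrite lerBrDr gerDl leNgt invr_gt0 N0.
Qed.

(** Symmetry makes range and kernel orthogonal, so they meet in 0 and rank-nullity gives the
    dimension. *)
Lemma sym_limg_lker S : symmetric_op d S -> (limg S + lker S = fullv)%VS.
Proof.
move=> symS; apply/eqP; rewrite eqEdim subvf dimv_disjoint_sum.
  by rewrite -(limg_ker_dim S fullv) capfv addnC leqnn.
apply/eqP; rewrite -subv0; apply/subvP => x.
rewrite memv_cap memv_ker memv0 => /andP[/memv_imgP[y _ ->] /eqP SSy].
by rewrite -dot_eq0 symS SSy linear0r.
Qed.

Lemma psd_eq0 S x : sym_pos_semidef d S -> d (S x) x = 0 -> S x = 0.
Proof.
move=> [symS psdS] Sx0; apply/eqP; rewrite -dot_eq0; apply/eqP.
(* [(S y, y) >= 0] at [y = (M + 1) x - a S x] reads [a^2 (M - 2 (M + 1)) >= 0]. *)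
have a0 := dot_ge0 (S x); have M0 := psdS (S x).
set a := d (S x) (S x) in a0 *; set M := d (S (S x)) (S x) in M0.
have := psdS ((M + 1) *: x - a *: S x).
have -> : S ((M + 1) *: x - a *: S x) = (M + 1) *: S x - a *: S (S x).
  by rewrite linearB !linearZ.
rewrite !dotE Sx0 (symS (S x) x) -/a -/M => pos.
apply/eqP; rewrite -sqrf_eq0 eq_le sqr_ge0 andbT; nra.
Qed.

(** Packs the energy form as an inner product, so that the results above apply to operators
    symmetric for it; used with [S = B^-1]. *)
Lemma dot_of_spd S : spd d S ->
  exists e : {dot V for idfun}, forall x y, e x y = d (S x) y.
Proof.
move=> [symS S_gt0]; pose f x y := d (S x) y.
have f_bil : bilinear_for *%R (idfun \; *%R) f.
  by split=> [z a x y|z a x y]; rewrite /f ?linearP ?linearPl ?linearPr.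
have f_herm x y : f x y = (-1) ^+ false * idfun (f y x).
  by rewrite expr0 mul1r /f /= symS dotC.
pose e : {dot V for idfun} := HB.pack f
  (bilinear_isBilinear.Build _ _ _ _ _ _ _ f_bil)
  (isHermitianSesquilinear.Build _ _ _ _ _ f_herm)
  (isDotProduct.Build R V f S_gt0).
by exists e.
Qed.

End Dot.

Lemma spd_lker0 (R : realType) (V : vectType R) (d : {dot V for idfun})
  (S : 'End(V)) : spd d S -> lker S == 0%VS.
Proof.
move=> [_ S_gt0]; rewrite -subv0; apply/subvP => x.
rewrite memv_ker memv0 => /eqP Sx; apply/negPn/negP => /S_gt0.
by rewrite Sx linear0l ltxx.
Qed.

Lemma spd_inv (R : realType) (V : vectType R) (d : {dot V for idfun})
  (S : 'End(V)) : spd d S -> spd d S^-1%VF.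
Proof.
move=> S_spd; have SK := lker0_lfunVK (spd_lker0 S_spd).
have [symS S_gt0] := S_spd; split=> [x y|x x0].
  by rewrite -{1}(SK y) -symS SK.
have -> : d (S^-1%VF x) x = d (S (S^-1%VF x)) (S^-1%VF x) by rewrite SK dotC.
by apply: S_gt0; apply: contra_neq x0 => x0; rewrite -(SK x) x0 linear0.
Qed.

(** * Minimal energy over the fibres of [Pi] *)

Section FictitiousSpace.
Variables (R : realType) (V Vt : vectType R).
Variables (ip : {dot V for idfun}) (ipt : {dot Vt for idfun}).
Variables (Pi : 'Hom(Vt, V)) (Bt : 'End(Vt)).
Hypotheses (Pi_surj : limg Pi = fullv) (Bt_spd : spd ipt Bt).
Let Pit := adjoint ipt ip Pi.
Let B : 'End(V) := (Pi \o Bt \o Pit)%VF.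

Let PitE w x : ip (Pi w) x = ipt w (Pit x).
Proof. exact: adjointP. Qed.

(** The form of [B] at [x] is that of [Bt] at [Pit x], and surjectivity of [Pi] makes [Pit]
    injective. *)
Lemma spd_pushforward : spd ip B.
Proof.
have [symBt Bt_gt0] := Bt_spd; split=> [x y|x x0].
  by rewrite !comp_lfunE PitE symBt dotC -PitE dotC.
rewrite !comp_lfunE PitE; apply: Bt_gt0.
apply: contra_neq x0 => Pitx0; apply/eqP; rewrite -(dot_eq0 ip).
have /memv_imgP[w _ {1}->] : x \in limg Pi by rewrite Pi_surj memvf.
by rewrite PitE Pitx0 linear0r.
Qed.

(* The infimum is attained at [Bt (Pit (B^-1 x))], which is orthogonal to
   [lker Pi] for the energy product of [Bt^-1]. *)
Lemma ereal_inf_preimage x :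
  ereal_inf [set (ipt (Bt^-1%VF w) w)%:E | w in [set w | Pi w = x]] =
  (ip (B^-1%VF x) x)%:E.
Proof.
have BK := lker0_lfunVK (spd_lker0 spd_pushforward).
have BtK := lker0_lfunK (spd_lker0 Bt_spd).
have [symBtV BtV_gt0] := spd_inv Bt_spd.
set y := B^-1%VF x; pose w0 := Bt (Pit y).
have Piw0 : Pi w0 = x by rewrite -[RHS]BK !comp_lfunE.
have Btw0 : Bt^-1%VF w0 = Pit y by rewrite BtK.
apply/eqP; rewrite eq_le; apply/andP; split.
  apply: ereal_inf_lbound; exists w0 => //.
  by rewrite Btw0 dotC -PitE Piw0 dotC.
apply: le_ereal_inf_tmp => _ [w Piw <-]; rewrite lee_fin.
have w0w : ipt (Bt^-1%VF w0) w = ip y x by rewrite Btw0 dotC -PitE Piw dotC.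
have w0w0 : ipt (Bt^-1%VF w0) w0 = ip y x by rewrite Btw0 dotC -PitE Piw0 dotC.
(* The cross term and the energy of [w0] both equal [ip y x], so this is the energy of [w] minus
   [ip y x]. *)
have : 0 <= ipt (Bt^-1%VF (w - w0)) (w - w0).
  have [->|/BtV_gt0/ltW //] := eqVneq (w - w0) 0.
  by rewrite linear0r.
have -> : Bt^-1%VF (w - w0) = Bt^-1%VF w - Bt^-1%VF w0 by rewrite linearB.
by rewrite !dotE (symBtV w w0) (dotC _ w) w0w w0w0; lra.
Qed.

End FictitiousSpace.

Lemma leigenvalueP (R : realType) (V : vectType R) (T : 'End(V)) (l : R) :
  reflect (exists2 x, x != 0 & T x = l *: x) (passmx.leigenvalue T l).
Proof.
have ker x : (x \in passmx.leigenspace T l) = (T x == l *: x).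
  by rewrite memv_ker add_lfunE opp_lfunE scale_lfunE id_lfunE subr_eq0.
rewrite /passmx.leigenvalue; apply: (iffP idP) => [E0|[x x0 Tx]].
  exists (vpick (passmx.leigenspace T l)); first by rewrite vpick0.
  by apply/eqP; rewrite -ker memv_pick.
by apply: contra_neq x0 => E0; apply/eqP; rewrite -memv0 -E0 ker Tx.
Qed.

(** * Extremal nonzero eigenvalues as minimal energies *)

Section Pencil.
Variables (R : realType) (V : vectType R) (ip e : {dot V for idfun}).
Variables (A T : 'End(V)).
Hypotheses (A_psd : sym_pos_semidef ip A) (A_neq0 : A != 0).
(** Holds for [T = B \o A] when [e] is the energy product of [B^-1]. *)
Hypothesis eT : forall x y, e (T x) y = ip (A x) y.

Let unit_range : set V := [set v | v \in limg A /\ seminorm_of ip A v = 1].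
Let energy v : \bar R :=
  ereal_inf [set (e (v + phi) (v + phi))%:E | phi in [set phi | phi \in lker A]].

Let symA : symmetric_op ip A. Proof. by case: A_psd. Qed.

Let symT : symmetric_op e T.
Proof. by move=> x y; rewrite eT symA dotC -eT dotC. Qed.

Let kerTA x : (T x == 0) = (A x == 0).
Proof.
apply/eqP/eqP => x0; first by apply: (@dot_inj _ _ ip) => z; rewrite -eT x0 !linear0l.
by apply: (@dot_inj _ _ e) => z; rewrite eT x0 !linear0l.
Qed.

Let seminorm_eq1 v : seminorm_of ip A v = 1 <-> ip (A v) v = 1.
Proof.
rewrite /seminorm_of; split=> [v1|->]; last exact: sqrtr1.
by rewrite -[LHS]sqr_sqrtr ?v1 ?expr1n //; case: A_psd => _; apply.
Qed.

Let form_ker x phi : phi \in lker A ->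
  ip (A (x + phi)) (x + phi) = ip (A x) x.
Proof.
rewrite memv_ker => /eqP phi0.
have -> : A (x + phi) = A x by rewrite linearD /= phi0 addr0.
by rewrite dotDr (symA x phi) phi0 linear0r addr0.
Qed.

Let decomp x : exists v phi, [/\ v \in limg A, phi \in lker A & x = v + phi].
Proof.
have /memv_addP[v vA [phi phiA ->]] : x \in (limg A + lker A)%VS.
  by rewrite (sym_limg_lker symA) memvf.
by exists v, phi.
Qed.

(** Here [ip (A x) x = l * e x x], so scaling the left side to 1 makes the energy [l^-1]: the source
    of the inverses in both formulas. *)
Let normalize l x : 0 < l -> x != 0 -> T x = l *: x ->
  exists y, [/\ T y = l *: y, ip (A y) y = 1 & e y y = l^-1].
Proof.
move=> l0 x0 Tx; have xx0 := @neq0_dnorm_gt0 _ _ _ e _ x0.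
have lxx0 : 0 < l * e x x by rewrite mulr_gt0.
pose t := (Num.sqrt (l * e x x))^-1.
have tt : t * t = (l * e x x)^-1.
  by rewrite -expr2 exprVn sqr_sqrtr // ltW.
have Ty : T (t *: x) = l *: (t *: x).
  by rewrite linearZ /= Tx !scalerA mulrC.
have yy : e (t *: x) (t *: x) = l^-1.
  rewrite !dotE mulrA tt invfM mulfVK // gt_eqF //.
exists (t *: x); split=> //.
by rewrite -eT Ty dotZl yy divff ?gt_eqF.
Qed.

Let lambda_max : exists2 l, is_lambda_max T l &
  l%:E = ((ereal_inf [set energy v | v in unit_range])^-1)%E.
Proof.
have [z Az0] : exists z, A z != 0.
  apply: contrapT => noz; case/eqP: A_neq0; apply/lfunP => z; rewrite lfunE /=.
  by apply/eqP/negPn/negP => Az0; apply: noz; exists z.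
have full0 : (@fullv _ V) != 0%VS.
  apply: contra_neq Az0 => full0.
  by apply/eqP; rewrite -memv0 -full0 memvf.
have [l [[x [_ x0 Tx]] lP]] := sym_max_eigenvector symT full0 (fun _ _ => memvf _).
have l0 : 0 < l.
  have := lP z (memvf z); rewrite eT => Azz.
  have Azz0 : 0 < ip (A z) z.
    rewrite lt_neqAle eq_sym (proj2 A_psd) andbT.
    by apply: contra_neq Az0; apply: psd_eq0.
  have := lt_le_trans Azz0 Azz.
  by rewrite pmulr_lgt0 // neq0_dnorm_gt0 //; apply: contra_neq Az0 => ->; rewrite linear0.
exists l.
  split; first by apply/leigenvalueP; exists x.
  move=> m /leigenvalueP[y y0 Ty]; have := lP y (memvf y).
  by rewrite Ty dotZl ler_pM2r // neq0_dnorm_gt0.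
have [y [Ty Ay yy]] := normalize l0 x0 Tx.
suff -> : ereal_inf [set energy v | v in unit_range] = (l^-1)%:E.
  (* Extended inversion agrees with real inversion only away from 0, hence the need for [0 < l]. *)
  by rewrite inver invr_eq0 gt_eqF // invrK.
apply/eqP; rewrite eq_le; apply/andP; split.
  (* The eigenvector [y] need not lie in the range of [A]; its range component [v] is admissible,
     and [y] is a representative of [v]. *)
  have [v [phi [vA phiA yE]]] := decomp y.
  apply: (@le_trans _ _ (energy v)).
    apply: ereal_inf_lbound; exists v => //; split=> //; apply/seminorm_eq1.
    by rewrite -(form_ker v phiA) -yE.
  by apply: ereal_inf_lbound; exists phi => //; rewrite -yE yy.
apply: le_ereal_inf_tmp => _ [v [vA /seminorm_eq1 v1] <-].
apply: le_ereal_inf_tmp => _ [phi phiA <-]; rewrite lee_fin.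
have := lP (v + phi) (memvf _); rewrite eT form_ker // v1 => h.
by rewrite -[leLHS]mulr1 ler_pdivrMl.
Qed.

(* Each [v] has a representative [v + phi] in [limg T], the [e]-orthogonal
   complement of [lker A]; it minimises the energy over the class of [v]. *)
Let lambda_min : exists2 l, is_lambda_min T l &
  l%:E = ((ereal_sup [set energy v | v in unit_range])^-1)%E.
Proof.
have imgT0 : limg T != 0%VS.
  apply: contra_neq A_neq0 => imgT0; apply/lfunP => z; rewrite lfunE /=.
  by apply/eqP; rewrite -kerTA -memv0 -imgT0 memv_img ?memvf.
have symNT : symmetric_op e (- T).
  by move=> x y; rewrite !opp_lfunE !dotE symT.
have [|m [[x [/memv_imgP[z _ xE] x0 NTx]] NlP]] := sym_max_eigenvector symNT imgT0.
  by move=> x _; rewrite opp_lfunE memvN memv_img ?memvf.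
pose l := - m.
have Tx : T x = l *: x by rewrite scaleNr -NTx opp_lfunE opprK.
have lP y : y \in limg T -> l * e y y <= ip (A y) y.
  by move=> /NlP; rewrite opp_lfunE dotNl eT /l; lra.
have l0 : 0 < l.
  rewrite lt_neqAle; apply/andP; split; last first.
    have := (proj2 A_psd) x; rewrite -eT Tx dotZl.
    by rewrite pmulr_lge0 // neq0_dnorm_gt0.
  (* As [x = T z], having [T x = 0] would force [e x x = e z (T x) = 0]. *)
  apply: contra_neq x0 => l0; apply/eqP; rewrite -(dot_eq0 e) {1}xE symT.
  by rewrite Tx -l0 scale0r linear0r.
exists l.
  split; [by apply/leigenvalueP; exists x|by rewrite gt_eqF|].
  move=> k /leigenvalueP[y y0 Ty] k0.
  have yT : y \in limg T.
    by rewrite -[y](scalerK k0) -Ty -linearZ memv_img ?memvf.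
  by have := lP y yT; rewrite -eT Ty dotZl ler_pM2r // neq0_dnorm_gt0.
have [y [Ty Ay yy]] := normalize l0 x0 Tx.
suff -> : ereal_sup [set energy v | v in unit_range] = (l^-1)%:E.
  by rewrite inver invr_eq0 gt_eqF // invrK.
apply/eqP; rewrite eq_le; apply/andP; split.
  apply: ge_ereal_sup => _ [v [vA /seminorm_eq1 v1] <-].
  have /memv_addP[u uT [psi psiT vE]] : v \in (limg T + lker T)%VS.
    by rewrite (sym_limg_lker symT) memvf.
  have psiA : - psi \in lker A.
    by rewrite memvN memv_ker -kerTA -memv_ker.
  apply: (@le_trans _ _ (e (v - psi) (v - psi))%:E).
    by apply: ereal_inf_lbound; exists (- psi).
  have uE : v - psi = u by rewrite vE addrK.
  rewrite lee_fin -[leRHS]mulr1 ler_pdivlMl //.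
  by rewrite -v1 -(form_ker v psiA) uE lP.
have [v [phi [vA phiA yE]]] := decomp y.
apply: (@le_trans _ _ (energy v)); last first.
  apply: ereal_sup_ubound; exists v => //; split=> //; apply/seminorm_eq1.
  by rewrite -(form_ker v phiA) -yE.
apply: le_ereal_inf_tmp => _ [psi psiA <-]; rewrite lee_fin.
(* Every representative of [v] is [y + chi] with [chi] in the kernel; [chi] is [e]-orthogonal to the
   eigenvector [y], so the energy is [l^-1 + e chi chi]. *)
have [chi chiA ->] : exists2 chi, chi \in lker A & v + psi = y + chi.
  exists (psi - phi); first by rewrite memvB.
  by rewrite yE addrACA subrr addr0 addrC.
have /eqP Achi : A chi == 0 by rewrite -memv_ker.
have ychi : l * e y chi = 0.
  by rewrite -dotZl -Ty eT symA Achi linear0r.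
have {}ychi : e y chi = 0.
  by apply/eqP; move/eqP: ychi; rewrite mulf_eq0 gt_eqF.
rewrite !(dotDl, dotDr) yy (dotC e chi y) ychi; have := dot_ge0 e chi; lra.
Qed.

Lemma pencil_extremal_eigenvalues :
  (exists2 l, is_lambda_min T l &
     l%:E = ((ereal_sup [set energy v | v in unit_range])^-1)%E) /\
  (exists2 l, is_lambda_max T l &
     l%:E = ((ereal_inf [set energy v | v in unit_range])^-1)%E).
Proof. by []. Qed.

End Pencil.

Theorem theorem5p2 (R : realType) (V Vt : vectType R)
    (ip : {dot V for idfun}) (ipt : {dot Vt for idfun})
    (A : 'End(V)) (A_psd : sym_pos_semidef ip A) (A_neq0 : A != 0)
    (Pi : 'Hom(Vt, V)) (Pi_surj : limg Pi = fullv)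
    (Bt : 'End(Vt)) (Bt_spd : spd ipt Bt) :
  let B : 'End(V) := (Pi \o Bt \o adjoint ipt ip Pi)%VF in
  let unit_range : set V :=
    [set v | v \in limg A /\ seminorm_of ip A v = 1] in
  let energy (v : V) : \bar R :=
    ereal_inf [set
      ereal_inf [set (ipt (Bt^-1%VF w) w)%:E | w in [set w | Pi w = v + phi]]
    | phi in [set phi | phi \in lker A]] in
  (exists2 lmin : R, is_lambda_min (B \o A)%VF lmin &
     lmin%:E = ((ereal_sup [set energy v | v in unit_range])^-1)%E) /\
  (exists2 lmax : R, is_lambda_max (B \o A)%VF lmax &
     lmax%:E = ((ereal_inf [set energy v | v in unit_range])^-1)%E).
Proof.
move=> B unit_range energy.
have B_spd : spd ip B := spd_pushforward ip Pi_surj Bt_spd.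
(* In the energy product of [B^-1], the infimum over preimages of [x] becomes [e x x]. *)
have [e eE] := dot_of_spd (spd_inv B_spd).
have energyE v : energy v =
    ereal_inf [set (e (v + phi) (v + phi))%:E | phi in [set phi | phi \in lker A]].
  congr ereal_inf; apply: eq_imagel => phi _.
  by rewrite (ereal_inf_preimage ip Pi_surj Bt_spd) eE.
have /funext -> : energy =1 _ := energyE.
apply: pencil_extremal_eigenvalues => // x y.
by rewrite eE comp_lfunE lker0_lfunK // (spd_lker0 B_spd).
Qed.
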